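(* If $p \equiv 1 \pmod 6$ is prime such that $2, 3, 6 \notin (\mathbb{Z}_p^* )^3$, then there is a factorisation of $K_p$ into $\mathrm{Cay}(\mathbb{Z}_p; \pm\{1, 3, 4\})$.
   Context: $(\mathbb{Z}_p^* )^3=\{x^3 : x\in\mathbb{Z}_p^*\}$, the subgroup of cubes in the unit group modulo $p$. For a group $G$ and a subset $S \subseteq G$ not containing the identity and closed under inverses, the Cayley graph $\mathrm{Cay}(G;S)$ has vertex set $G$, with $g$ adjacent to $g s$ for each $s \in S$. $\pm\{a_1,\dots,a_s\}$ denotes $\{\pm a_1,\dots,\pm a_s\}$. A factorisation of a graph into $H$ is a decomposition of its edge set into edge-disjoint spanning subgraphs each isomorphic to $H$. *)

(* Defs.v *)
From mathcomp Require Import all_boot all_fingroup all_algebra.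

Set Implicit Arguments.
Unset Strict Implicit.
Unset Printing Implicit Defensive.

Import GRing.Theory.
Local Open Scope ring_scope.

(* A graph on the vertex set [T] is its adjacency relation [e : rel T]. *)
Definition simple_graph (T : finType) (e : rel T) : Prop :=
  symmetric e /\ irreflexive e.

Definition complete_graph (T : finType) : rel T := [rel x y | x != y].
Arguments complete_graph T : clear implicits.

Definition graph_iso (T U : finType) (e : rel T) (h : rel U) : Prop :=
  exists2 f : T -> U, bijective f & forall x y, h (f x) (f y) = e x y.

(* Every [F i] lives on the whole vertex type [T], hence is spanning. *)
Definition factorisation_into (T U : finType) (e : rel T) (h : rel U) : Prop :=
  exists (k : nat) (F : 'I_k -> rel T),
    [/\ forall i, simple_graph (F i),
        forall i, subrel (F i) e,
        forall i j x y, F i x y -> F j x y -> i = j,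
        forall x y, e x y -> exists i, F i x y
      & forall i, graph_iso (F i) h].

Definition connection_set (gT : finGroupType) (S : {set gT}) : Prop :=
  (1%g \notin S) /\ (forall s, s \in S -> (s^-1)%g \in S).

Definition Cay (gT : finGroupType) (S : {set gT}) : rel gT :=
  [rel g h | [exists s in S, h == (g * s)%g]].

Definition pm (R : finZmodType) (A : {set R}) : {set R} :=
  A :|: [set - a | a in A].

Definition unit_cubes (R : finUnitRingType) : {set R} :=
  [set x ^+ 3 | x in [set y : R | y \is a GRing.unit]].

Lemma Cay_simple (gT : finGroupType) (S : {set gT}) :
  connection_set S -> simple_graph (Cay S).
Proof.
move=> [S1 SV]; split=> [g h | g] /=.
  by apply/exists_inP/exists_inP => -[s sS /eqP ->]; exists (s^-1)%g;
    rewrite ?SV // mulgK.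
apply/negbTE/exists_inP => -[s sS]; rewrite -{1}[g]mulg1.
by rewrite (inj_eq (mulgI g)) => /eqP s1; rewrite s1 sS in S1.
Qed.

(* On ['F_p] the group law of the [finGroupType] structure is addition, so
   [Cay] of a subset of ['F_p] is over the additive group of integers mod p. *)
Lemma connection_set_pm134 (p : nat) : prime p -> p = 1 %[mod 6] ->
  connection_set (pm [set 1; 3; 4 : 'F_p]).
Proof.
move=> p_pr p1.
have p4 : (4 < p)%N by move: p_pr p1; do 5?[case: p => [//|p]].
have nz n : (0 < n < p)%N -> (n%:R : 'F_p) != 0.
  case/andP=> n0 np; rewrite -(dvdn_pcharf (pchar_Fp p_pr)).
  by apply/negP=> /(dvdn_leq n0); rewrite leqNgt np.
have S0 a : a \in [set 1; 3; 4 : 'F_p] -> a != 0.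
  rewrite !inE -orbA => /or3P[] /eqP ->; first exact: oner_neq0.
  - by apply: nz; rewrite (ltn_trans _ p4).
  - exact: nz.
split.
  rewrite inE negb_or; apply/andP; split; first by apply/negP=> /S0 /eqP.
  by apply/imsetP => -[a /S0 a0 /esym/eqP]; rewrite oppr_eq0 (negbTE a0).
move=> s; rewrite !inE => /orP[sA|/imsetP[a aA ->]].
  by apply/orP; right; apply/imsetP; exists s; rewrite ?inE.
by apply/orP; left; move: aA; rewrite !inE -[((- a)^-1)%g]/(- - a) opprK.
Qed.

(* Main.v *)
(* The cosets of the cubes form a group of order 3, in which neither of the
   classes of 2 and 3 nor their product is trivial; so 2 and 3 lie in the same
   coset, and 1, 3, 4 represent the three cosets.  Hence every nonzero residue
   is uniquely a cube times an element of {1, 3, 4}, and the dilates of the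
   Cayley graph by the pairs of cubes {c, -c} partition the edges of K_p. *)
Require Import Defs.
From mathcomp Require Import all_boot all_fingroup all_algebra.
From mathcomp Require Import cyclic finfield.
From mathcomp Require Import ring.
Import GRing.Theory.
Local Open Scope ring_scope.

Lemma expf_card_eq1 (F : finFieldType) (x : F) : x != 0 -> x ^+ #|F|.-1 = 1.
Proof.
move=> x0; apply: (mulfI x0); rewrite -exprS prednK ?mulr1 ?expf_card //.
by apply/card_gt0P; exists 0.
Qed.

(** The nonzero elements are [#|F|.-1] distinct roots of unity of that exponent, and so many
    distinct roots force a primitive one among them. *)
Lemma finField_prim_root (F : finFieldType) :
  exists z : F, #|F|.-1.-primitive_root z.
Proof.
have F1 : (0 < #|F|.-1)%N by rewrite -subn1 subn_gt0 finNzRing_gt1.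
suff /hasP[z _ zP] : has #|F|.-1.-primitive_root (enum (predC1 (0 : F))).
  by exists z.
apply: has_prim_root => //.
- by apply/allP=> x; rewrite mem_enum => x0; apply/unity_rootP/expf_card_eq1.
- exact: enum_uniq.
- by rewrite -cardE cardC1.
Qed.

(** Cubic analogue of Euler's criterion: for [x = z ^+ i] with [z] primitive of order [3 * m],
    [x ^+ m = 1] forces [3 * m] to divide [i * m], hence 3 to divide [i]. *)
Lemma mem_unit_cubes (F : finFieldType) (m : nat) (x : F) :
  #|F|.-1 = (3 * m)%N -> (x \in unit_cubes F) = (x != 0) && (x ^+ m == 1).
Proof.
move=> Fm; apply/imsetP/andP => [[y]|[x0 /eqP xm]].
  rewrite inE unitfE => y0 ->; split; first by rewrite expf_neq0.
  by rewrite -exprM -Fm expf_card_eq1.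
have [z zP] := finField_prim_root F.
have m0 : (0 < m)%N by have := prim_order_gt0 zP; rewrite Fm; case: (m).
have [i def_x] := prim_rootP zP (expf_card_eq1 _ _ x0).
have : (#|F|.-1 %| i * m)%N by rewrite (prim_order_dvd zP) exprM -def_x xm.
rewrite {1}Fm dvdn_pmul2r // => /dvdnP[j def_i].
exists (z ^+ j); last by rewrite -exprM -def_i.
rewrite inE unitfE; apply: contraNneq x0 => zj0.
by rewrite def_x def_i exprM zj0 expr0n.
Qed.

Lemma unit_cubesN (F : finFieldType) (x : F) :
  x \in unit_cubes F -> - x \in unit_cubes F.
Proof.
case/imsetP=> y; rewrite inE => yU ->; apply/imsetP; exists (- y).
  by rewrite inE unitrN.
by ring.
Qed.

(** The map [x ^+ m] with [3 * m = #|F|.-1] is a cubic character whose kernel is the group of cubes,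
    so it separates the three cosets. *)
Lemma unit_cubes_transversal (F : finFieldType) (a b : F) :
    #|F| = 1 %[mod 3] -> a != 0 -> b != 0 ->
    a \notin unit_cubes F -> b \notin unit_cubes F ->
    a * b \notin unit_cubes F ->
  let A := [set 1; b; a ^+ 2] in
    (forall d : F, d != 0 -> exists c s, [/\ c \in unit_cubes F, s \in A & d = c * s])
    /\ (forall c c' s s', c \in unit_cubes F -> c' \in unit_cubes F ->
          s \in A -> s' \in A -> c * s = c' * s' -> c = c').
Proof.
move=> F3 a0 b0 aC bC abC A.
have [m Fm] : exists m, #|F|.-1 = (3 * m)%N.
  exists (#|F| %/ 3)%N.
  by rewrite {1}(divn_eq #|F| 3) F3 addn1 mulnC.
have C := mem_unit_cubes _ _ _ Fm.
move: aC bC abC; rewrite !C mulf_neq0 // a0 b0 /= exprMn => a1 b1 ab1.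
have m3 (x : F) : x != 0 -> (x ^+ m) ^+ 3 = 1.
  by move=> x0; rewrite -exprM mulnC -Fm expf_card_eq1.
(* Cancel [x ^+ m - 1] in the factorisation of [(x ^+ m) ^+ 3 - 1 = 0]. *)
have root_w (x : F) : x != 0 -> x ^+ m != 1 -> (x ^+ m) ^+ 2 + x ^+ m + 1 = 0.
  move=> x0; rewrite -subr_eq0 => x1; apply: (mulfI x1).
  by ring: (m3 x x0).
have := root_w a a0 a1; have := root_w b b0 b1; move: (m3 a a0) a1 b1 ab1.
set w := a ^+ m; set v := b ^+ m => w3 w1 v1 wv1 rv rw.
have vw : v = w.
  apply/eqP; rewrite -subr_eq0; apply: contraR wv1 => vw.
  (* The other root of X^2 + X + 1 is the inverse of w. *)
  rewrite -subr_eq0; apply/eqP/(mulfI vw); rewrite mulr0.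
  have -> : (v - w) * (w * v - 1) = w * ((v ^+ 2 + v + 1) - (w ^+ 2 + w + 1))
      - (v - w) * (w ^+ 2 + w + 1) by ring.
  by rewrite rv rw subr0 !mulr0 subr0.
have aE : (a ^+ 2) ^+ m = w ^+ 2 by rewrite exprAC.
have w0 : w != 0 by rewrite expf_neq0.
have w2w : w ^+ 2 != w by rewrite expr2 -subr_eq0 -{3}[w]mulr1 -mulrBr
  mulf_neq0 // subr_eq0.
have w21 : w ^+ 2 != 1.
  by apply: contraNneq w1 => w2; rewrite -w3 exprS w2 mulr1.
have A0 s : s \in A -> s != 0.
  by rewrite !inE -orbA => /or3P[] /eqP->; rewrite ?oner_neq0 ?expf_neq0.
(* The character takes the distinct values [1], [w], [w ^+ 2] at [1], [b], [a ^+ 2]. *)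
have Ainj : {in A &, injective (fun x => x ^+ m)}.
  move=> s t; rewrite !inE -!orbA.
  move=> /or3P[] /eqP-> /or3P[] /eqP->; rewrite ?expr1n ?aE -/v ?vw // => /eqP;
    by rewrite ?(negbTE w1) ?(negbTE w21) ?(negbTE w2w)
      1?eq_sym ?(negbTE w1) ?(negbTE w21) ?(negbTE w2w).
split=> [d d0 | c c' s s'].
  have [s sA ds] : exists2 s, s \in A & d ^+ m = s ^+ m.
    (* [d ^+ m] is a cube root of unity, and X^3 - 1 splits with roots [1], [w], [w ^+ 2]. *)
    have /eqP : (d ^+ m - 1) * (d ^+ m - w) * (d ^+ m - w ^+ 2) = 0.
      set t := d ^+ m.
      have -> : (t - 1) * (t - w) * (t - w ^+ 2) = (t ^+ 3 - 1) - (w ^+ 3 - 1)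
          - (w ^+ 2 + w + 1) * (t ^+ 2 - w * t) by ring.
      by rewrite rw w3 m3 // !subrr mul0r subr0.
    rewrite !mulf_eq0 !subr_eq0 -orbA => /or3P[] /eqP->.
    - by exists 1; rewrite ?expr1n // !inE eqxx.
    - by exists b; rewrite -?vw // !inE eqxx orbT.
    - by exists (a ^+ 2); rewrite ?aE // !inE eqxx orbT.
  have s0 := A0 s sA; exists (d / s), s; split; rewrite ?divfK //.
  rewrite C mulf_neq0 ?invr_eq0 //= exprMn exprVn ds divff //.
  by rewrite expf_neq0.
rewrite !C => /andP[_ /eqP c1] /andP[_ /eqP c1'] sA sA' eq_cs.
(* Taking [m]-th powers erases the cubes [c] and [c']. *)
have eq_s : s = s'.
  apply: Ainj => //=; have := congr1 (fun x => x ^+ m) eq_cs.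
  by rewrite !exprMn c1 c1' !mul1r.
by move: eq_cs; rewrite eq_s; apply: mulIf; apply: A0.
Qed.

Lemma factorisation_by_dilation (F : finFieldType) (T : finType) (g : T -> F)
    (C A : {set F}) :
    bijective g -> 0 \notin C -> 0 \notin A ->
    (forall c, c \in C -> - c \in C) ->
    (forall d : F, d != 0 -> exists c s, [/\ c \in C, s \in A & d = c * s]) ->
    (forall c c' s s', c \in C -> c' \in C -> s \in A -> s' \in A ->
       c * s = c' * s' -> c = c') ->
  factorisation_into (complete_graph T) (@Cay F (pm A)).
Proof.
move=> g_bij C0 A0 CN ex_cs uniq_cs.
(* Factors are indexed by pairs because [c] and [- c] yield the same graph. The sign in [pm A] is
   carried by the block, so [E] only mentions [A]. *)
pose P : {set {set F}} := [set [set c; - c] | c in C].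
pose E (B : {set F}) : rel T :=
  [rel x y | [exists c in B, exists s in A, g y - g x == c * s]].
have EP (B : {set F}) x y : reflect (exists c s, [/\ c \in B, s \in A & g y - g x = c * s])
    (E B x y).
  apply: (iffP exists_inP) => [[c cB /exists_inP[s sA /eqP eq_xy]]|].
    by exists c, s.
  case=> c [s [cB sA eq_xy]]; exists c => //; apply/exists_inP.
  by exists s; rewrite ?eq_xy.
have blockP (B : {set F}) c : B \in P -> c \in B -> c \in C /\ B = [set c; - c].
  case/imsetP=> c0 c0C -> /set2P[]->; split=> //; first exact: CN.
  by rewrite opprK setUC.
have blockN (B : {set F}) c : B \in P -> c \in B -> - c \in B.
  by move=> BP /(blockP _ _ BP)[_ ->]; rewrite set22.
exists #|P|, (fun i => E (enum_val i)).
have irrE (i : 'I_#|P|) x : ~~ E (enum_val i) x x.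
  apply/EP=> -[c [s [cB sA /esym/eqP]]]; rewrite subrr mulf_eq0.
  have [cC _] := blockP _ _ (enum_valP i) cB.
  by case/orP=> /eqP e; move: C0 A0; rewrite -e ?cC ?sA.
split=> [i | i x y | i j x y | x y xy | i].
- split=> [x y | x]; last exact/negbTE.
  have sE u v : E (enum_val i) u v -> E (enum_val i) v u.
    move/EP=> [c [s [cB sA e]]]; apply/EP; exists (- c), s.
    by rewrite (blockN _ _ (enum_valP i)) // mulNr -e opprB.
  by apply/idP/idP; apply: sE.
- by move=> Exy; apply: contraTneq Exy => ->; apply: irrE.
(* A shared edge writes one difference as both [c * s] and [c' * s']; then [c = c'], and a block is
   determined by any of its elements. *)
- move=> /EP[c [s [cB sA e]]] /EP[c' [s' [cB' sA' e']]].
  have [cC defB] := blockP _ _ (enum_valP i) cB.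
  have [cC' defB'] := blockP _ _ (enum_valP j) cB'.
  apply: enum_val_inj; rewrite defB defB'.
  by rewrite (uniq_cs c c' s s') // -e.
- have [|c [s [cC sA e]]] := ex_cs (g y - g x).
    by rewrite subr_eq0 (bij_eq g_bij) eq_sym.
  have BP : [set c; - c] \in P by apply/imsetP; exists c.
  exists (enum_rank_in BP [set c; - c]); apply/EP; exists c, s.
  by rewrite enum_rankK_in // set21.
- have /imsetP[c cC ->] := enum_valP i.
  have c0 : c != 0 by apply: contraNneq C0 => <-.
  (* Division by [c] turns the differences [c * s] and [- c * s] into [s] and [- s]. *)
  exists (fun x => g x / c) => [|x y].
    have divc_bij : bijective (fun u : F => u / c).
      by exists (fun u => u * c) => u; rewrite ?divfK ?mulfK.
    exact: bij_comp divc_bij g_bij.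
  apply/exists_inP/EP => [[s sS /eqP e]|[c' [s [c'B sA e]]]].
    have {}e : g y - g x = c * s.
      (* The group product in [Cay] is addition of [F] by conversion. *)
      have {}e : g y / c = g x / c + s by [].
      by rewrite -[g y](divfK c0) e mulrDl divfK // addrC addKr mulrC.
    case/setUP: sS => [sA|/imsetP[t tA defs]].
      by exists c, s; rewrite set21.
    by exists (- c), t; rewrite set22 mulNr -mulrN -defs.
  have gyE : g y = g x + c' * s by rewrite -e addrC subrK.
  case/set2P: c'B gyE => -> gyE.
    exists s; first by rewrite inE sA.
    apply/eqP; rewrite gyE.
    by change ((g x + c * s) / c = g x / c + s); rewrite mulrDl mulrAC divff ?mul1r.
  exists (- s); first by rewrite inE imset_f ?orbT.
  apply/eqP; rewrite gyE.
  change ((g x + - c * s) / c = g x / c + - s).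
  by rewrite mulrDl mulNr mulNr mulrAC divff ?mul1r.
Qed.

Theorem theorem4 (p : nat) (p_prime : prime p) (p_mod6 : p = 1 %[mod 6])
  (h2 : (2 : 'F_p) \notin unit_cubes 'F_p)
  (h3 : (3 : 'F_p) \notin unit_cubes 'F_p)
  (h6 : (6 : 'F_p) \notin unit_cubes 'F_p) :
  factorisation_into (complete_graph 'I_p) (@Cay 'F_p (pm [set 1; 3; 4 : 'F_p])).
Proof.
have p3 : (3 < p)%N.
  by move: p_prime p_mod6; clear h2 h3 h6; do 4?[case: p => [//|p]].
have nz n : (0 < n <= 3)%N -> (n%:R : 'F_p) != 0.
  case/andP=> n0 n3; rewrite -(dvdn_pcharf (pchar_Fp p_prime)).
  by apply/negP=> /(dvdn_leq n0); rewrite leqNgt (leq_ltn_trans n3).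
have card_mod3 : #|'F_p| = 1 %[mod 3].
  by rewrite card_Fp // -(modn_dvdm p (isT : 3 %| 6)%N) p_mod6.
have h23 : (2 : 'F_p) * 3 \notin unit_cubes 'F_p by rewrite -natrM.
(* With [a = 2] and [b = 3] the transversal is 1, 3, 2^2. *)
have [ex_cs uniq_cs] :=
  unit_cubes_transversal _ 2 3 card_mod3 (nz 2 isT) (nz 3 isT) h2 h3 h23.
have -> : (4 : 'F_p) = 2 ^+ 2 by rewrite -natrX.
(* The carrier of ['F_p] is an ordinal type whose bound equals [p] only propositionally, for [p]
   prime, hence the cast. *)
have g_bij : bijective (cast_ord (esym (Fp_cast p_prime))).
  exists (cast_ord (Fp_cast p_prime)); [exact: cast_ordKV | exact: cast_ordK].
apply: (factorisation_by_dilation _ _ _ (unit_cubes 'F_p) _ g_bij) => //.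
- apply/imsetP=> -[x]; rewrite inE unitfE => x0 /esym/eqP.
  by rewrite expf_eq0 (negbTE x0).
- rewrite !inE !negb_or [0 == 1]eq_sym oner_neq0 ![0 == _]eq_sym.
  by rewrite expf_neq0 ?nz.
- exact: unit_cubesN.
Qed.
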